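(* Let $G$ be a finite simple connected graph with weights $w:V(G)\to[0,\infty)$ and $w':E(G)\to[0,\infty)$, and let $\{F_1,\ldots,F_k\}$ be a c-partition of $E(G)$. For each $i$ let $G_i=G/F_i$, let $\lambda_i:V(G_i)\to[0,\infty)$ be $\lambda_i(X)=\sum_{x\in V(X)}w(x)$, and let $\lambda_i':E(G_i)\to[0,\infty)$ be $\lambda_i'(XY)=\sum_{e\in\widehat{XY}}w'(e)$, where $\widehat{XY}=\{xy\in E(G): x\in V(X),\,y\in V(Y)\}$. Then $$Mo(G,w,w')=\sum_{i=1}^k Mo(G_i,\lambda_i,\lambda_i').$$
   Context: For a connected graph $H$ with weights $\omega:V(H)\to[0,\infty)$, $\omega':E(H)\to[0,\infty)$ and an edge $e=uv$, let $N_u(e|H)=\{x\in V(H): d_H(x,u)<d_H(x,v)\}$ ($d_H$ the shortest-path distance), $n_u(e|(H,\omega))=\sum_{x\in N_u(e|H)}\omega(x)$, and symmetrically for $v$. The Mostar index of the weighted graph is $Mo(H,\omega,\omega')=\sum_{e=uv\in E(H)}\omega'(e)\,|n_u(e|(H,\omega))-n_v(e|(H,\omega))|$. Two edges $e=xy$, $f=ab$ of $G$ are in relation $\Theta$ if $d_G(x,a)+d_G(y,b)\neq d_G(x,b)+d_G(y,a)$; $\Theta^*$ is the transitive closure of $\Theta$. A partition of $E(G)$ is a c-partition if every $\Theta^*$-class is contained in some part. For $F\subseteq E(G)$, the quotient graph $G/F$ has as vertices the connected components of $G\setminus F$ (delete the edges of $F$), two components being adjacent iff some vertex of one is adjacent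 in $G$ to some vertex of the other. *)

(* Defs.v *)
From mathcomp Require Import all_boot all_order all_algebra reals.

Set Implicit Arguments.
Unset Strict Implicit.
Unset Printing Implicit Defensive.

Import Order.TTheory GRing.Theory Num.Theory.
Local Open Scope ring_scope.

Record sgraph := SGraph {
  vertex :> finType;
  adj : rel vertex;
  adj_sym : symmetric adj;
  adj_irr : irreflexive adj }.
Arguments adj {s}.
Arguments SGraph {vertex adj}.

Definition connected_graph (H : sgraph) : Prop :=
  forall x y : H, connect adj x y.

Definition edges (H : sgraph) : {set {set H}} :=
  [set [set p.1; p.2] | p : H * H & adj p.1 p.2].

Definition walk_of_length (H : sgraph) (x y : H) (n : nat) : bool :=
  [exists p : n.-tuple H, path adj x p && (last x p == y)].

(* The least length of a walk from x to y. Distances between vertices in the  *)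
(* same component are < #|H|, so searching 0, ..., #|H| - 1 suffices; on      *)
(* disconnected pairs the value is the junk value #|H|.                       *)
Definition dist (H : sgraph) (x y : H) : nat :=
  find (walk_of_length x y) (iota 0 #|H|).

Section Mostar.
Variables (R : realType) (H : sgraph) (w : H -> R) (w' : {set H} -> R).

(* N_u(e|H) for the edge e = uv *)
Definition closer (u v : H) : {set H} := [set x | (dist x u < dist x v)%N].

Definition closer_weight (u v : H) : R := \sum_(x in closer u v) w x.

(* |n_u(e) - n_v(e)| for e = uv; the choice of the ordering (u, v) of the     *)
(* endpoints is immaterial, see imbalanceE.                                   *)
Definition imbalance (e : {set H}) : R :=
  if [pick p : H * H | adj p.1 p.2 && (e == [set p.1; p.2])] is Some p
  then `|closer_weight p.1 p.2 - closer_weight p.2 p.1| else 0.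

Definition mostar : R := \sum_(e in edges H) w' e * imbalance e.

End Mostar.

(* The inequality is invariant under swapping x and y, or a and b, so it does *)
(* not depend on the ordering of the endpoints of e and f.                    *)
Definition Theta (G : sgraph) (e f : {set G}) : bool :=
  [exists p : G * G, exists q : G * G,
    [&& adj p.1 p.2, e == [set p.1; p.2], adj q.1 q.2, f == [set q.1; q.2]
      & (dist p.1 q.1 + dist p.2 q.2 != dist p.1 q.2 + dist p.2 q.1)%N]].

(* connect is the reflexive transitive closure; on edges Theta is already     *)
(* reflexive (Theta_refl).                                                    *)
Definition Theta_star_classes (G : sgraph) : {set {set {set G}}} :=
  equivalence_partition (connect (@Theta G)) (edges G).

Definition c_partition (G : sgraph) (P : {set {set {set G}}}) : Prop :=
  partition P (edges G) /\
  forall C, C \in Theta_star_classes G -> exists2 F, F \in P & C \subset F.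

Section Quotient.
Variables (G : sgraph) (F : {set {set G}}).

Definition del_adj : rel G := fun x y => adj x y && ([set x; y] \notin F).

Lemma del_adj_sym : symmetric del_adj.
Proof. by move=> x y; rewrite /del_adj adj_sym setUC. Qed.

Lemma del_adj_irr : irreflexive del_adj.
Proof. by move=> x; rewrite /del_adj adj_irr. Qed.

Definition del_edges : sgraph := SGraph del_adj_sym del_adj_irr.

Definition components (H : sgraph) : {set {set H}} :=
  equivalence_partition (connect (@adj H)) [set: H].

Definition quotient_vertex : finType :=
  {X : {set G} | X \in components del_edges}.

Definition quotient_adj : rel quotient_vertex := fun X Y =>
  (X != Y) && [exists x in val X, exists y in val Y, @adj G x y].

Lemma quotient_adj_sym : symmetric quotient_adj.
Proof.
move=> X Y; rewrite /quotient_adj eq_sym; congr (_ && _).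
by apply/exists_inP/exists_inP => -[x xX /exists_inP[y yY xy]];
  exists y => //; apply/exists_inP; exists x => //; rewrite adj_sym.
Qed.

Lemma quotient_adj_irr : irreflexive quotient_adj.
Proof. by move=> X; rewrite /quotient_adj eqxx. Qed.

Definition quotient_graph : sgraph := SGraph quotient_adj_sym quotient_adj_irr.

Definition edges_between (X Y : quotient_graph) : {set {set G}} :=
  [set [set p.1; p.2] | p : G * G &
    [&& adj p.1 p.2, p.1 \in val X & p.2 \in val Y]].

(* edges_between as a function of the unordered pair XY, see edges_overE *)
Definition edges_over (XY : {set quotient_graph}) : {set {set G}} :=
  \bigcup_(p : quotient_graph * quotient_graph | XY == [set p.1; p.2])
    edges_between p.1 p.2.

Variables (R : realType) (w : G -> R) (w' : {set G} -> R).

Definition quotient_vweight (X : quotient_graph) : R := \sum_(x in val X) w x.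

Definition quotient_eweight (XY : {set quotient_graph}) : R :=
  \sum_(e in edges_over XY) w' e.

End Quotient.
Arguments quotient_vweight {G} F {R} w.
Arguments quotient_eweight {G} F {R} w'.

Lemma eq_set2 (T : finType) (a b c d : T) : [set a; b] = [set c; d] ->
  (a = c /\ b = d) \/ (a = d /\ b = c).
Proof.
move=> E.
have := set21 a b; have := set22 a b; rewrite E !inE.
have := set21 c d; have := set22 c d; rewrite -E !inE.
by do 4![case/orP=> /eqP ?]; subst; auto.
Qed.

Lemma dist_le (H : sgraph) (x : H) (p : seq H) :
  path adj x p -> (dist x (last x p) <= size p)%N.
Proof.
move=> xp; rewrite leqNgt; apply/negP => lt_p.
have lt_p' : (size p < #|H|)%N.
  by apply: leq_trans lt_p _; rewrite -[X in (_ <= X)%N](size_iota 0) find_size.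
have := before_find 0%N lt_p; rewrite nth_iota // add0n => /existsP[].
by exists (in_tuple p); rewrite xp eqxx.
Qed.

Lemma dist_walk (H : sgraph) (x y : H) : connect adj x y ->
  exists p, [/\ path adj x p, last x p = y & size p = dist x y].
Proof.
case/connectP=> p0 /shortenP[p xp up _ ->].
have lt_p : (size p < #|H|)%N.
  by have := card_uniqP up => /= <-; apply: max_card.
have hasw : has (walk_of_length x (last x p)) (iota 0 #|H|).
  apply/hasP; exists (size p); first by rewrite mem_iota.
  by apply/existsP; exists (in_tuple p); rewrite xp eqxx.
have := nth_find 0%N hasw; rewrite nth_iota; last first.
  by move: hasw; rewrite has_find size_iota.
case/existsP=> q /andP[xq /eqP lq].
by exists q; split=> //; rewrite size_tuple.
Qed.

Lemma mem_edges (H : sgraph) (x y : H) : ([set x; y] \in edges H) = adj x y.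
Proof.
apply/imsetP/idP => [[[a b]]|xy]; last by exists (x, y); rewrite ?inE.
by rewrite inE /= => ab /eq_set2[] [-> ->] //; rewrite adj_sym.
Qed.

Lemma imbalanceE (R : realType) (H : sgraph) (w : H -> R) (u v : H) :
  adj u v ->
  imbalance w [set u; v] = `|closer_weight w u v - closer_weight w v u|.
Proof.
move=> uv; rewrite /imbalance; case: pickP => [[a b] /= /andP[_ /eqP]|].
  by case/eq_set2=> -[-> ->] //; rewrite distrC.
by move/(_ (u, v)); rewrite /= uv eqxx.
Qed.

Lemma dist0 (H : sgraph) (x : H) : dist x x = 0%N.
Proof. by apply/eqP; rewrite -leqn0 (@dist_le _ x [::]). Qed.

Lemma dist_eq0 (H : sgraph) (x y : H) : connect adj x y ->
  dist x y = 0%N -> x = y.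
Proof. by case/dist_walk=> p [_ <- <-] /size0nil->. Qed.

Lemma Theta_refl (G : sgraph) (e : {set G}) : e \in edges G -> Theta e e.
Proof.
case/imsetP=> -[x y]; rewrite inE /= => xy ->.
apply/existsP; exists (x, y); apply/existsP; exists (x, y).
rewrite /= xy eqxx /= !dist0 eq_sym addn_eq0 negb_and; apply/orP; left.
apply/eqP => /(dist_eq0 (connect1 xy)) exy.
by rewrite exy adj_irr in xy.
Qed.

Lemma ThetaE (G : sgraph) (x y a b : G) : adj x y -> adj a b ->
  Theta [set x; y] [set a; b] =
  (dist x a + dist y b != dist x b + dist y a)%N.
Proof.
move=> xy ab; apply/idP/idP => [|ne]; last first.
  apply/existsP; exists (x, y); apply/existsP; exists (a, b).
  by rewrite /= xy ab !eqxx.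
case/existsP=> -[x' y'] /existsP[[a' b']] /=.
case/and5P=> _ /eqP/eq_set2 exy _ /eqP/eq_set2 eab.
by case: exy eab => -[-> ->] [] [-> ->] //;
  rewrite 1?eq_sym // addnC [X in _ != X]addnC // eq_sym.
Qed.

Lemma edges_overE (G : sgraph) (F : {set {set G}}) (X Y : quotient_graph F) :
  edges_over [set X; Y] = edges_between X Y.
Proof.
apply/setP=> e; apply/bigcupP/idP => [[[A B] /= /eqP/eq_set2]|eXY]; last first.
  by exists (X, Y).
case=> -[-> ->] // /imsetP[[x y]]; rewrite inE /= => /and3P[xy xX yY] ->.
by apply/imsetP; exists (y, x); rewrite /= 1?setUC // inE /= adj_sym xy yY xX.
Qed.

Lemma quotient_vweight_ge0 (R : realType) (G : sgraph) (F : {set {set G}})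
    (w : G -> R) : (forall x, 0 <= w x) -> forall X, 0 <= quotient_vweight F w X.
Proof. by move=> w0 X; apply: sumr_ge0. Qed.

Lemma quotient_eweight_ge0 (R : realType) (G : sgraph) (F : {set {set G}})
    (w' : {set G} -> R) : (forall e, e \in edges G -> 0 <= w' e) ->
  forall XY, 0 <= quotient_eweight F w' XY.
Proof.
move=> w0 XY; apply: sumr_ge0 => e /bigcupP[p _ /imsetP[[x y]]].
by rewrite inE /= => /and3P[xy _ _] ->; apply: w0; rewrite mem_edges.
Qed.

Lemma connected_quotient (G : sgraph) (F : {set {set G}}) :
  connected_graph G -> connected_graph (quotient_graph F).
Proof.
move=> cG X Y.
have eqv : {in [set: del_edges F] & &,
    equivalence_rel (connect (@adj (del_edges F)))}.
  move=> x y z _ _ _; split=> [|xy]; first exact: connect0.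
  exact: (same_connect (sym_connect_sym (@adj_sym (del_edges F))) xy).
have /and3P[/eqP cov triv _] := equivalence_partitionP eqv.
have cP x : pblock (components (del_edges F)) x \in components (del_edges F).
  by apply: pblock_mem; rewrite cov inE.
pose c (x : G) : quotient_graph F :=
  exist (fun X : {set G} => X \in components (del_edges F)) _ (cP x).
have mc x : x \in val (c x) by rewrite mem_pblock cov inE.
have cE (Z : quotient_graph F) x : x \in val Z -> c x = Z.
  by move=> xZ; apply/val_inj/(def_pblock triv (valP Z)).
have ne (Z : quotient_graph F) : exists x, x \in val Z.
  have /imsetP[x _ ->] := valP Z.
  by exists x; rewrite inE in_setT connect0.
have [[x /cE <-] [y /cE <-]] := (ne X, ne Y).
case/connectP: (cG x y) => p xp ->.
elim: p x xp => [|z p IHp] x /=; first by rewrite connect0.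
case/andP=> xz /IHp; apply: connect_trans.
have [->|cxz] := eqVneq (c x) (c z); first exact: connect0.
apply/connect1; rewrite /= /quotient_adj cxz.
by apply/exists_inP; exists x => //; apply/exists_inP; exists z.
Qed.

(* Main.v *)
Require Import Defs.
From mathcomp Require Import all_boot all_order all_algebra reals.
From mathcomp Require Import zify ring.

(** Let [F] be a union of [Theta*]-classes. Summing the defect
    [d(b,u) - d(b,v) - d(a,u) + d(a,v)] over the edges [uv] in [F] of a geodesic
    and the edges [ab] of a walk with the same endpoints, and telescoping in
    either order, shows that a geodesic minimises the number of [F]-edges among
    all walks (Graham-Winkler). Hence the distance in [G/F] between the
    components of [x] and [y] is the number of [F]-edges on a geodesic from [x]
    to [y]. The complement of [F] is a union of [Theta*]-classes as well, and
    the endpoints of an edge [uv] of [F] are joined by a walk without edges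
    outside [F], so [d(x,u) - d(x,v)] is the same in [G] and in [G/F]. Thus [uv]
    has the same imbalance as its image in [G/F], and the formula follows by
    grouping the edges of [G] first by part and then by image. *)

Set Implicit Arguments.
Unset Strict Implicit.
Unset Printing Implicit Defensive.

Import Order.TTheory GRing.Theory Num.Theory.
Local Open Scope ring_scope.

Lemma edgesP (H : sgraph) (e : {set H}) :
  reflect (exists u v : H, adj u v /\ e = [set u; v]) (e \in edges H).
Proof.
apply: (iffP imsetP) => [[[u v]]|[u [v [uv ->]]]].
  by rewrite inE => uv ->; exists u, v.
by exists (u, v); rewrite ?inE.
Qed.

Section Distance.
Variables (H : sgraph) (connH : connected_graph H).
Implicit Types x y z : H.

Lemma dist_triangle y x z : (dist x z <= dist x y + dist y z)%N.
Proof.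
have [p [xp lp <-]] := dist_walk (connH x y).
have [q [yq lq <-]] := dist_walk (connH y z).
have := @dist_le _ x (p ++ q); rewrite cat_path last_cat size_cat lp lq xp yq.
exact.
Qed.

Lemma dist_adj x y : adj x y -> (dist x y <= 1)%N.
Proof. by move=> xy; apply: (@dist_le _ x [:: y]); rewrite /= xy. Qed.

Lemma dist_sym x y : dist x y = dist y x.
Proof.
suff le_d (a b : H) : (dist a b <= dist b a)%N by apply/eqP; rewrite eqn_leq !le_d.
have [p [bp <- <-]] := dist_walk (connH b a).
elim: p b bp => [|z p IHp] b /=; first by rewrite dist0.
case/andP=> bz /IHp le_p; apply: leq_trans (dist_triangle z _ _) _.
by rewrite -addn1 leq_add // dist_adj // adj_sym.
Qed.

End Distance.

Section WalkSum.
Variable T : Type.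
Implicit Types (f g : T -> T -> int) (x : T) (p : seq T).

Fixpoint walk_sum f x p : int :=
  if p is y :: p' then f x y + walk_sum f y p' else 0.

Lemma walk_sum_telescope (h : T -> int) x p :
  walk_sum (fun a b => h b - h a) x p = h (last x p) - h x.
Proof. by elim: p x => [|y p IHp] x /=; rewrite ?subrr // IHp; ring. Qed.

Lemma walk_sumZ c f x p :
  walk_sum (fun a b => c * f a b) x p = c * walk_sum f x p.
Proof. by elim: p x => [|y p IHp] x /=; rewrite ?mulr0 // IHp mulrDr. Qed.

Lemma walk_sumD f g x p :
  walk_sum (fun a b => f a b + g a b) x p = walk_sum f x p + walk_sum g x p.
Proof. by elim: p x => [|y p IHp] x /=; rewrite ?addr0 // IHp addrACA. Qed.

Lemma walk_sum0 x p : walk_sum (fun _ _ => 0) x p = 0.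
Proof. by elim: p x => //= y p IHp x; rewrite IHp addr0. Qed.

Lemma walk_sum_exchange (k : T -> T -> T -> T -> int) x p y q :
  walk_sum (fun a b => walk_sum (k a b) y q) x p =
  walk_sum (fun u v => walk_sum (fun a b => k a b u v) x p) y q.
Proof.
elim: p x => [|z p IHp] x /=; first by rewrite walk_sum0.
by rewrite IHp walk_sumD.
Qed.

End WalkSum.

Section WalkSumPath.
Variables (T : eqType) (e : rel T).

Lemma eq_walk_sum (f g : T -> T -> int) x p : path e x p ->
  (forall a b, e a b -> f a b = g a b) -> walk_sum f x p = walk_sum g x p.
Proof.
move=> xp fg; elim: p x xp => //= y p IHp x /andP[xy yp].
by rewrite fg // IHp.
Qed.

Lemma le_walk_sum (f g : T -> T -> int) x p : path e x p ->
  (forall a b, e a b -> f a b <= g a b) -> walk_sum f x p <= walk_sum g x p.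
Proof.
move=> xp fg; elim: p x xp => //= y p IHp x /andP[xy yp].
by rewrite lerD ?fg // IHp.
Qed.

End WalkSumPath.

Section Geodesics.
Variables (G : sgraph) (connG : connected_graph G).
Implicit Types (F : {set {set G}}) (x y u v : G) (p q : seq G).

Definition edge_count F x p : int :=
  walk_sum (fun a b => ([set a; b] \in F)%:Z) x p.

Definition Theta_closed F : Prop :=
  forall e f, Theta e f -> (e \in F) = (f \in F).

Lemma Theta_closedC F : Theta_closed F -> Theta_closed (~: F).
Proof. by move=> clF e f /clF; rewrite !inE => ->. Qed.

Lemma edge_countC F x p :
  edge_count F x p + edge_count (~: F) x p = (size p)%:Z.
Proof.
rewrite /edge_count; elim: p x => //= y p IHp x; rewrite inE.
by have := IHp y; case: (_ \in F) => /=; lia.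
Qed.

Lemma edge_count_cat F x p q :
  edge_count F x (p ++ q) = edge_count F x p + edge_count F (last x p) q.
Proof.
by rewrite /edge_count; elim: p x => [|y p IHp] x /=; rewrite ?add0r // IHp addrA.
Qed.

Definition defect (a b u v : G) : int :=
  (dist b u)%:Z - (dist b v)%:Z - (dist a u)%:Z + (dist a v)%:Z.

Lemma defect_closed F a b u v : Theta_closed F -> adj a b -> adj u v ->
  ([set u; v] \in F)%:Z * defect a b u v =
  ([set a; b] \in F)%:Z * defect a b u v.
Proof.
move=> clF ab uv.
have [/clF -> //|] := boolP (Theta [set a; b] [set u; v]).
rewrite ThetaE // negbK => /eqP E.
by rewrite (_ : defect _ _ _ _ = 0) ?mulr0 // /defect; lia.
Qed.

Lemma defect_along_walk u v x q :
  walk_sum (fun a b => defect a b u v) x q =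
  (dist (last x q) u)%:Z - (dist (last x q) v)%:Z
    - ((dist x u)%:Z - (dist x v)%:Z).
Proof.
rewrite -(walk_sum_telescope (fun b => (dist b u)%:Z - (dist b v)%:Z)).
by elim: q x => //= z q IHq x; rewrite IHq; congr (_ + _); rewrite /defect; ring.
Qed.

Lemma defect_along_walk_le a b x p : adj a b ->
  walk_sum (defect a b) x p <= 2.
Proof.
move=> ab.
have -> : walk_sum (defect a b) x p = (dist b x)%:Z - (dist a x)%:Z
    - ((dist b (last x p))%:Z - (dist a (last x p))%:Z).
  have := walk_sum_telescope (fun u => (dist a u)%:Z - (dist b u)%:Z) x p.
  set s := walk_sum _ _ _ => Es; suff -> : walk_sum (defect a b) x p = s by lia.
  rewrite /s; elim: p x {s Es} => //= z p IHp x.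
  by rewrite IHp; congr (_ + _); rewrite /defect; ring.
have := dist_triangle connG a b x.
have := dist_triangle connG b a (last x p).
by have := dist_adj ab; have := dist_adj (etrans (adj_sym b a) ab); lia.
Qed.

Definition geodesic x p : Prop := path adj x p /\ size p = dist x (last x p).

Lemma geodesic_exists x y : exists2 p, geodesic x p & last x p = y.
Proof.
have [p [xp lp sp]] := dist_walk (connG x y).
by exists p => //; split; rewrite // lp.
Qed.

Lemma geodesic_defect F x y p : geodesic x p -> last x p = y ->
  walk_sum (fun u v => ([set u; v] \in F)%:Z *
    ((dist y u)%:Z - (dist y v)%:Z - ((dist x u)%:Z - (dist x v)%:Z))) x p
  = 2 * edge_count F x p.
Proof.
case=> xp sp lp; rewrite /edge_count -walk_sumZ.
suff gen u : path adj u p -> last u p = y -> dist x y = (dist x u + size p)%N ->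
    walk_sum (fun u v => ([set u; v] \in F)%:Z *
      ((dist y u)%:Z - (dist y v)%:Z - ((dist x u)%:Z - (dist x v)%:Z))) u p
    = walk_sum (fun a b => 2 * ([set a; b] \in F)%:Z) u p.
  by apply: gen => //; rewrite dist0 sp lp.
elim: p u {xp sp lp} => //= v p IHp u /andP[uv vp] lp spu.
have := dist_le vp; rewrite lp => dvy.
have := dist_triangle connG u x v; have := dist_triangle connG v x y.
have := dist_triangle connG u x y; have := dist_triangle connG v u y.
have := dist_adj uv => duv t1 t2 t3 t4.
rewrite IHp //; last by lia.
by congr (_ + _); rewrite !(dist_sym connG y) mulrC; congr (_ * _); lia.
Qed.

Lemma geodesic_edge_count_le F x p q : Theta_closed F ->
  geodesic x p -> path adj x q -> last x q = last x p ->
  edge_count F x p <= edge_count F x q.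
Proof.
move=> clF gp xq lq; have [xp _] := gp.
rewrite -(@ler_pM2l _ 2) // -(geodesic_defect F gp erefl).
rewrite (eq_walk_sum (g := fun u v =>
    walk_sum (fun a b => ([set u; v] \in F)%:Z * defect a b u v) x q) xp);
  last by move=> u v _; rewrite walk_sumZ defect_along_walk lq.
rewrite -walk_sum_exchange -walk_sumZ; apply: (le_walk_sum xq) => a b ab.
rewrite (eq_walk_sum (g := fun u v => ([set a; b] \in F)%:Z * defect a b u v) xp);
  last by move=> u v; apply: defect_closed.
by rewrite walk_sumZ mulrC ler_wpM2r // defect_along_walk_le.
Qed.

(* Appending the edge between the two endpoints, which lies outside [F], to one
   geodesic gives a competitor for the other with the same number of [F]-edges. *)
Lemma geodesic_edge_count_adj F x p q : Theta_closed F ->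
  geodesic x p -> geodesic x q -> adj (last x p) (last x q) ->
  [set last x p; last x q] \notin F -> edge_count F x p = edge_count F x q.
Proof.
move=> clF; suff le_pq p1 q1 : geodesic x p1 -> geodesic x q1 ->
    adj (last x p1) (last x q1) -> [set last x p1; last x q1] \notin F ->
    edge_count F x q1 <= edge_count F x p1.
  move=> gp gq pq nF; apply/eqP; rewrite eq_le !le_pq //.
  - by rewrite adj_sym.
  - by rewrite setUC.
move=> gp gq pq nF; have [xp _] := gp.
have := @geodesic_edge_count_le F x q1 (rcons p1 (last x q1)) clF gq.
rewrite rcons_path last_rcons xp pq -cats1 edge_count_cat => /(_ isT erefl).
by rewrite /edge_count /= (negPf nF) !addr0.
Qed.

End Geodesics.

Section QuotientDistance.
Variables (G : sgraph) (F : {set {set G}}).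
Implicit Types (x y u v : G) (X Y : quotient_graph F).

Let del_connect_eqv : {in [set: del_edges F] & &,
  equivalence_rel (connect (@adj (del_edges F)))}.
Proof.
move=> x y z _ _ _; split=> [|xy]; first exact: connect0.
exact: (same_connect (sym_connect_sym (@adj_sym (del_edges F))) xy).
Qed.

Lemma component_subproof x :
  pblock (components (del_edges F)) x \in components (del_edges F).
Proof.
have /and3P[/eqP cov _ _] := equivalence_partitionP del_connect_eqv.
by apply: pblock_mem; rewrite cov inE.
Qed.

Definition component x : quotient_graph F :=
  exist (fun X : {set G} => X \in components (del_edges F)) _
    (component_subproof x).

Lemma component_eqE x y :
  (component x == component y) = connect (@adj (del_edges F)) x y.
Proof.
have /and3P[/eqP cov triv _] := equivalence_partitionP del_connect_eqv.
rewrite -(inj_eq val_inj) /= eq_pblock ?cov ?inE //.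
by rewrite (pblock_equivalence_partition del_connect_eqv) ?inE.
Qed.

Lemma mem_quotient_vertex x X : (x \in val X) = (component x == X).
Proof.
have /and3P[/eqP cov triv _] := equivalence_partitionP del_connect_eqv.
apply/idP/eqP => [xX|<-]; first exact/val_inj/(def_pblock triv (valP X)).
by rewrite mem_pblock cov inE.
Qed.

Lemma component_adj_eq u v : adj u v -> [set u; v] \notin F ->
  component u = component v.
Proof.
by move=> uv nF; apply/eqP; rewrite component_eqE connect1 //= /del_adj uv.
Qed.

Lemma component_adj u v : adj u v -> component u != component v ->
  adj (component u) (component v).
Proof.
move=> uv ne; rewrite /= /quotient_adj ne.
apply/exists_inP; exists u; first by rewrite mem_quotient_vertex.
by apply/exists_inP; exists v; rewrite ?mem_quotient_vertex.
Qed.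

Hypothesis connG : connected_graph G.

Lemma component_dist_le x p : path adj x p ->
  (dist (component x) (component (last x p)))%:Z <= edge_count F x p.
Proof.
have connQ := @connected_quotient G F connG.
rewrite /edge_count; elim: p x => [|y p IHp] x /=; first by rewrite dist0.
case/andP=> xy /IHp le_p.
have [xyF|xyNF] := boolP (_ \in F); last by rewrite (component_adj_eq xy) // add0r.
apply: le_trans (_ : (dist (component x) (component y) +
  dist (component y) (component (last y p)))%:Z <= _).
  exact: dist_triangle.
rewrite PoszD lerD //.
have [->|ne] := eqVneq (component x) (component y); first by rewrite dist0.
exact/dist_adj/component_adj.
Qed.

Lemma same_component_walk x y : component x = component y ->
  exists p, [/\ path adj x p, last x p = y & edge_count F x p = 0].
Proof.
move/eqP; rewrite component_eqE => /connectP[p xp ->]; exists p; split=> //.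
  by apply: sub_path xp => a b /andP[].
rewrite /edge_count; elim: p x xp => //= z p IHp x /andP[/andP[_ nF] /IHp->].
by rewrite (negPf nF).
Qed.

Lemma component_walk_lift x y P : path adj (component x) P ->
  last (component x) P = component y ->
  exists p, [/\ path adj x p, last x p = y & edge_count F x p <= (size P)%:Z].
Proof.
elim: P x => [|Z P IHP] x /=.
  by move=> _ /same_component_walk[p [xp lp cp]]; exists p; rewrite cp.
case/andP=> /andP[_ /exists_inP[a xa /exists_inP[b bZ ab]]].
move: bZ; rewrite mem_quotient_vertex => /eqP <- bP /(IHP _ bP)[q [bq lq cq]].
move: xa; rewrite mem_quotient_vertex => /eqP Eax.
have [p [xp lp cp]] := same_component_walk (esym Eax).
exists (p ++ b :: q); rewrite cat_path last_cat /= lp xp ab bq lq; split=> //.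
rewrite edge_count_cat cp lp add0r /edge_count /=.
by apply: le_trans (lerD (_ : _ <= 1) cq) _; [case: (_ \in F) | rewrite -PoszD].
Qed.

Lemma component_dist x p : Theta_closed F -> geodesic x p ->
  (dist (component x) (component (last x p)))%:Z = edge_count F x p.
Proof.
move=> clF gp; have [xp _] := gp.
apply/eqP; rewrite eq_le component_dist_le //=.
have [P [xP lP <-]] := dist_walk (@connected_quotient G F connG
  (component x) (component (last x p))).
have [q [xq lq]] := component_walk_lift xP lP.
by apply: le_trans; apply: geodesic_edge_count_le.
Qed.

Hypothesis clF : Theta_closed F.

Lemma component_neq u v : adj u v ->
  (component u != component v) = ([set u; v] \in F).
Proof.
move=> uv; apply/idP/idP => [|uvF].
  by apply: contraNT => nF; rewrite (component_adj_eq uv).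
have geo : geodesic u [:: v].
  split; rewrite /= ?uv //; apply/esym/eqP; rewrite eqn_leq dist_adj // lt0n.
  by apply/eqP => /(dist_eq0 (connG u v)) E; rewrite E adj_irr in uv.
have := component_dist clF geo; rewrite /edge_count /= uvF addr0.
by apply: contra_eqN => /eqP ->; rewrite dist0.
Qed.

Lemma closer_component x u v : adj u v -> [set u; v] \in F ->
  (component x \in closer (component u) (component v)) = (x \in closer u v).
Proof.
move=> uv uvF; rewrite !inE.
have [p gp lp] := geodesic_exists connG x u.
have [q gq lq] := geodesic_exists connG x v.
have := component_dist clF gp; have := component_dist clF gq.
have := edge_countC F x p; have := edge_countC F x q.
have := geodesic_edge_count_adj connG (Theta_closedC clF) gp gq.
have [_ ->] := gp; have [_ ->] := gq.
by rewrite lp lq inE negbK => /(_ uv uvF); lia.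
Qed.

Variables (R : realType) (w : G -> R) (w' : {set G} -> R).

Lemma closer_weight_component u v : adj u v -> [set u; v] \in F ->
  closer_weight (quotient_vweight F w) (component u) (component v) =
  closer_weight w u v.
Proof.
move=> uv uvF; rewrite /closer_weight.
rewrite (partition_big component (mem (closer (component u) (component v)))) /=.
  apply: eq_bigr => X Xuv; apply: eq_bigl => x; rewrite mem_quotient_vertex.
  have [EX|] := eqVneq (component x) X; last by rewrite andbF.
  by rewrite -(closer_component x uv uvF) EX Xuv.
by move=> x; rewrite closer_component.
Qed.

Lemma imbalance_component u v : adj u v -> [set u; v] \in F ->
  imbalance (quotient_vweight F w) [set component u; component v] =
  imbalance w [set u; v].
Proof.
move=> uv uvF; rewrite !imbalanceE //; last first.
  by apply: component_adj; rewrite ?component_neq.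
by rewrite !closer_weight_component // 1?adj_sym 1?setUC.
Qed.

Lemma mem_edges_over X Y e : e \in edges G ->
  (e \in edges_over [set X; Y]) = (component @: e == [set X; Y]).
Proof.
case/edgesP=> u [v [uv ->]].
rewrite edges_overE imsetU1 imset_set1; apply/imsetP/eqP.
  case=> -[a b]; rewrite inE /= !mem_quotient_vertex => /and3P[_ /eqP<- /eqP<-].
  by case/eq_set2=> -[-> ->]; rewrite // setUC.
case/eq_set2=> -[Eu Ev]; [exists (u, v) | exists (v, u)] => //=;
  by rewrite ?inE /= ?mem_quotient_vertex ?Eu ?Ev ?eqxx ?uv ?(adj_sym v) ?uv // setUC.
Qed.

Hypothesis subF : F \subset edges G.

Lemma mostar_quotient :
  mostar (quotient_vweight F w) (quotient_eweight F w') =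
  \sum_(e in F) w' e * imbalance w e.
Proof.
have imF e : e \in F -> component @: e \in edges (quotient_graph F).
  move=> eF; have /edgesP[u [v [uv Ee]]] := subsetP subF e eF.
  move: eF; rewrite Ee imsetU1 imset_set1 mem_edges => uvF.
  by apply: component_adj; rewrite ?component_neq.
rewrite (partition_big _ (mem (edges (quotient_graph F))) imF) /=.
apply: eq_bigr => E /edgesP[X [Y [XY ->]]].
rewrite /quotient_eweight mulr_suml; apply: congr_big => // [e|e].
  have [eG|eNG] := boolP (e \in edges G); last first.
    rewrite (contraNF (subsetP subF e) eNG); apply: contraNF eNG.
    rewrite edges_overE => /imsetP[[u v]]; rewrite inE /= => /and3P[uv _ _] ->.
    by rewrite mem_edges.
  rewrite mem_edges_over //; have [EXY|] := eqVneq; last by rewrite andbF.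
  case/edgesP: eG EXY => u [v [uv ->]].
  rewrite imsetU1 imset_set1 andbT -component_neq // => EXY.
  apply/esym/negP => /eqP Euv; move: XY; rewrite -mem_edges -EXY Euv.
  by rewrite mem_edges adj_irr.
rewrite edges_overE => /imsetP[[u v]]; rewrite inE /=.
rewrite !mem_quotient_vertex => /and3P[uv /eqP EX /eqP EY] ->.
rewrite -EX -EY imbalance_component // -component_neq // EX EY.
by case/andP: XY.
Qed.

End QuotientDistance.

Lemma c_partition_Theta_closed (G : sgraph) (P : {set {set {set G}}}) F :
  c_partition P -> F \in P -> Theta_closed F.
Proof.
case=> /and3P[_ triv _] cP FP e f ef.
have [eG fG] : e \in edges G /\ f \in edges G.
  case/existsP: ef => p /existsP[q /and5P[pp /eqP-> qq /eqP-> _]].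
  by rewrite !mem_edges.
have [|F' F'P /subsetP subF'] := cP [set g in edges G | connect (@Theta G) e g].
  exact: imset_f.
have eF' : e \in F' by apply: subF'; rewrite inE eG connect0.
have fF' : f \in F' by apply: subF'; rewrite inE fG connect1.
have F'E g : g \in F' -> g \in F -> F' = F.
  by move=> gF' gF; rewrite -(def_pblock triv F'P gF') (def_pblock triv FP gF).
by apply/idP/idP => [/(F'E _ eF')|/(F'E _ fF')] <-.
Qed.

Theorem theorem3p4 (R : realType) (G : sgraph) (w : G -> R)
    (w' : {set G} -> R) (k : nat) (F : 'I_k -> {set {set G}}) :
  connected_graph G ->
  (forall x : G, 0 <= w x) ->
  (forall e : {set G}, e \in edges G -> 0 <= w' e) ->
  injective F ->
  c_partition [set F i | i : 'I_k] ->
  mostar w w' =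
    \sum_(i < k)
      mostar (quotient_vweight (F i) w) (quotient_eweight (F i) w').
Proof.
move=> connG _ _ injF cF; have [partF _] := cF.
have FP i : F i \in [set F i | i : 'I_k] by apply: imset_f.
rewrite /mostar (set_partition_big _ partF) big_imset /=; last exact: in2W.
apply: eq_big => // i _; rewrite -mostar_quotient //.
  exact: c_partition_Theta_closed (FP i).
by have /and3P[/eqP<- _ _] := partF; apply: bigcup_sup.
Qed.
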